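(* Let $a<b$, $m>0$, $V\in C^2(\mathbb{R})$, and let $\xi_*\in C^2([a,b])$ satisfy $$m\cosh(\dot\xi_*(t))\,\ddot\xi_*(t)+V'(\xi_*(t))=0\quad\text{on }[a,b].$$ If there exists a time $c\in(a,b)$ conjugate to $a$ along $\xi_*$, then $\xi_*$ is not a strict local minimizer of $\mathcal{L}_V$ on the class of $C^1$ endpoint-fixed variations $\mathcal{V}=\{\xi_*+\eta:\eta\in C^1([a,b]),\ \eta(a)=\eta(b)=0\}$ (locality measured in the $C^1$ norm).
   Context: For a $C^1$ curve $\xi:[a,b]\to\mathbb{R}$, $\mathcal{L}_V[\xi]:=\int_a^b\bigl[m(\cosh(\dot\xi(t))-1)-V(\xi(t))\bigr]\,dt$. The Jacobi equation along $\xi_*$ is $\frac{d}{dt}\bigl(m\cosh(\dot\xi_*(t))\,\dot\eta(t)\bigr)+V''(\xi_*(t))\,\eta(t)=0$. A time $c\in(a,b]$ is conjugate to $a$ along $\xi_*$ if there is a nonzero $C^2$ solution $\eta$ of the Jacobi equation with $\eta(a)=0$ and $\eta(c)=0$. Being a strict local minimizer on $\mathcal{V}$ means: there is $\epsilon>0$ such that $\mathcal{L}_V[\xi_*+\eta]>\mathcal{L}_V[\xi_*]$ for all $\eta\in C^1([a,b])$ with $\eta(a)=\eta(b)=0$ and $0<\|\eta\|_{C^1}<\epsilon$, where $\|\eta\|_{C^1}=\sup|\eta|+\sup|\dot\eta|$. *)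

(* Defs.v *)
From Stdlib Require Import Reals Lra.
From Coquelicot Require Import Coquelicot.
Open Scope R_scope.

Definition Icc (a b : R) : R -> Prop := fun t => a <= t <= b.

(** Calculus on the closed interval [[a, b]]: difference quotients and limits
    are taken inside [[a, b]], hence one-sided at the endpoints, so only the
    restriction of [f] to [[a, b]] matters. *)

Definition ex_derive_on (a b : R) (f : R -> R) (t : R) : Prop :=
  exists l : R, D_in f (fun _ => l) (Icc a b) t.

(** Specified only where [ex_derive_on a b f t] holds. *)
Definition Derive_on (a b : R) (f : R -> R) (t : R) : R :=
  iota (T := R_CompleteSpace) (fun l : R => D_in f (fun _ => l) (Icc a b) t).

Definition C1_on (a b : R) (f : R -> R) : Prop :=
  forall t, Icc a b t ->
    ex_derive_on a b f t /\ continue_in (Derive_on a b f) (Icc a b) t.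

Definition C2_on (a b : R) (f : R -> R) : Prop :=
  C1_on a b f /\ C1_on a b (Derive_on a b f).

Definition C2 (V : R -> R) : Prop :=
  forall x, ex_derive V x /\ ex_derive (Derive V) x
            /\ continuous (Derive (Derive V)) x.

(** A finite supremum whenever [f] is bounded on a nonempty [[a, b]]. *)
Definition sup_norm (a b : R) (f : R -> R) : R :=
  real (Lub_Rbar (fun y => exists t, Icc a b t /\ y = Rabs (f t))).

Definition C1_norm (a b : R) (f : R -> R) : R :=
  sup_norm a b f + sup_norm a b (Derive_on a b f).

Definition action (m : R) (V : R -> R) (a b : R) (xi : R -> R) : R :=
  RInt (fun t => m * (cosh (Derive_on a b xi t) - 1) - V (xi t)) a b.

Definition euler_lagrange (m : R) (V : R -> R) (a b : R) (xi : R -> R) : Prop :=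
  forall t, Icc a b t ->
    m * cosh (Derive_on a b xi t) * Derive_on a b (Derive_on a b xi) t
    + Derive V (xi t) = 0.

Definition jacobi (m : R) (V : R -> R) (a b : R) (xi eta : R -> R) : Prop :=
  forall t, Icc a b t ->
    Derive_on a b (fun s => m * cosh (Derive_on a b xi s) * Derive_on a b eta s) t
    + Derive (Derive V) (xi t) * eta t = 0.

Definition conjugate (m : R) (V : R -> R) (a b : R) (xi : R -> R) (c : R) : Prop :=
  a < c <= b /\
  exists eta : R -> R,
    C2_on a b eta /\ jacobi m V a b xi eta
    /\ (exists t, Icc a b t /\ eta t <> 0)
    /\ eta a = 0 /\ eta c = 0.

Definition strict_local_minimizer (m : R) (V : R -> R) (a b : R)
    (xi : R -> R) : Prop :=
  exists eps : R, 0 < eps /\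
    forall eta : R -> R,
      C1_on a b eta -> eta a = 0 -> eta b = 0 ->
      0 < C1_norm a b eta < eps ->
      action m V a b (fun t => xi t + eta t) > action m V a b xi.

Lemma Derive_on_unique (a b : R) (f : R -> R) (t l : R) :
  a < b -> Icc a b t -> D_in f (fun _ => l) (Icc a b) t ->
  Derive_on a b f t = l.
Proof.
intros Hab [Hat Htb] Hl.
apply (iota_unique (V := R_CompleteNormedModule)); [|exact Hl].
intros l' Hl'.
refine (single_limit _ (D_x (Icc a b) t) l' l t _ Hl' Hl).
intros e He; unfold D_x, Icc, Rdist.
destruct (Rlt_dec t b) as [H|H].
- exists (t + Rmin (e / 2) (b - t)).
  assert (0 < Rmin (e / 2) (b - t)) by (apply Rmin_pos; lra).
  pose proof (Rmin_l (e / 2) (b - t)); pose proof (Rmin_r (e / 2) (b - t)).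
  split; [lra | rewrite Rabs_right; lra].
- exists (t - Rmin (e / 2) (t - a)).
  assert (0 < Rmin (e / 2) (t - a)) by (apply Rmin_pos; lra).
  pose proof (Rmin_l (e / 2) (t - a)); pose proof (Rmin_r (e / 2) (t - a)).
  split; [lra | rewrite Rabs_left; lra].
Qed.

Lemma Derive_on_correct (a b : R) (f : R -> R) (t : R) :
  a < b -> Icc a b t -> ex_derive_on a b f t ->
  D_in f (Derive_on a b f) (Icc a b) t.
Proof.
intros Hab Ht [l Hl]; unfold D_in.
rewrite (Derive_on_unique a b f t l Hab Ht Hl); exact Hl.
Qed.

(* Main.v *)
(** A Jacobi field [u] vanishing at [a] and [c], extended by [0] after [c], is a
    null direction of the second variation [Q] with a corner at [c]
    ([u'(c) <> 0] by uniqueness for the Jacobi equation), so adding a small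
    multiple of a function [phi] makes [Q] negative. The corner is rounded by
    replacing [u] with [u (1 - w^2)], where [w = e / (c - t + e)]: this is
    [C^1] after extension by [0], since [u] and [1 - w^2] both vanish at [c].
    With [W = P u'], so that [W' = - q u], and [th = 1 - w^2],
      [P (u th + d phi)'^2 - q (u th + d phi)^2
        = (W (u th^2 + 2 d phi th))' + P u^2 th'^2
          + 2 d th' (P u phi' - W phi) + d^2 (P phi'^2 - q phi^2)],
    and as [e] tends to [0] the term in [th'^2] vanishes while [- th']
    concentrates at [c]. Once [Q < 0] in a [C^1] direction [h], the action
    [s |-> L(xi + s h)] has first derivative [0] and negative second derivative
    at [s = 0]. *)

Require Import Defs.
From Stdlib Require Import Reals Lra.
From Coquelicot Require Import Coquelicot.
Open Scope R_scope.

(** * Calculus on a closed interval and extension to the whole line *)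

(** For [a <= b] this is the retraction of the line onto the interval. Composing with it turns
    continuity relative to the interval into ordinary continuity everywhere. *)
Definition clamp (a b t : R) : R := Rmax a (Rmin b t).

Lemma clamp_Icc (a b t : R) : a <= b -> Icc a b (clamp a b t).
Proof.
intros Hab; unfold Icc, clamp, Rmax, Rmin.
destruct (Rle_dec b t), (Rle_dec _ _); lra.
Qed.

Lemma clamp_id (a b t : R) : Icc a b t -> clamp a b t = t.
Proof.
unfold Icc, clamp, Rmax, Rmin; intros Ht.
destruct (Rle_dec b t), (Rle_dec _ _); lra.
Qed.

Lemma clamp_lipschitz (a b s t : R) :
  Rabs (clamp a b s - clamp a b t) <= Rabs (s - t).
Proof.
unfold clamp, Rmax, Rmin.
destruct (Rle_dec b s), (Rle_dec b t); repeat destruct (Rle_dec _ _);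
  unfold Rabs; repeat destruct (Rcase_abs _); lra.
Qed.

Lemma continuous_clamp (a b : R) (f : R -> R) (t : R) :
  a <= b -> (forall s, Icc a b s -> continue_in f (Icc a b) s) ->
  continuous (fun s => f (clamp a b s)) t.
Proof.
intros Hab Hf.
apply continuity_pt_filterlim; intros e He.
destruct (Hf _ (clamp_Icc a b t Hab) e He) as [d [Hd Hfd]].
exists d; split; [exact Hd|]; intros s [_ Hs]; simpl in *.
(* [continue_in] only tests points different from the base point, so the case where clamping merges
   [s] and [t] is treated apart. *)
destruct (Req_dec (clamp a b s) (clamp a b t)) as [E|E].
- rewrite E; unfold Rdist; rewrite Rminus_diag, Rabs_R0; exact He.
- apply Hfd; split.
  + split; [apply clamp_Icc, Hab | now apply not_eq_sym].
  + unfold Rdist in *.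
    apply Rle_lt_trans with (2 := Hs); apply clamp_lipschitz.
Qed.

Lemma is_derive_D_in_interior (a b : R) (f : R -> R) (t l : R) :
  a < t < b -> D_in f (fun _ => l) (Icc a b) t -> is_derive f t l.
Proof.
intros Ht Hf; apply is_derive_Reals; intros e He.
destruct (Hf e He) as [d [Hd Hfd]].
assert (Hr : 0 < Rmin d (Rmin (t - a) (b - t)))
  by (repeat apply Rmin_pos; lra).
exists (mkposreal _ Hr); intros h Hh0 Hh; simpl in Hh.
pose proof (Rmin_l d (Rmin (t - a) (b - t))).
pose proof (Rmin_r d (Rmin (t - a) (b - t))).
pose proof (Rmin_l (t - a) (b - t)).
pose proof (Rmin_r (t - a) (b - t)).
assert (Hh' := Rabs_def2 _ _ Hh).
specialize (Hfd (t + h)); simpl in Hfd; unfold Rdist in Hfd.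
replace (t + h - t) with h in Hfd by ring.
apply Hfd; unfold D_x, Icc; repeat split; lra.
Qed.

Lemma D_in_is_derive (D : R -> Prop) (f g : R -> R) (t l : R) :
  D t -> (forall s, D s -> f s = g s) -> is_derive g t l ->
  D_in f (fun _ => l) D t.
Proof.
intros Ht Hfg Hg e He; apply is_derive_Reals in Hg.
destruct (Hg e He) as [d Hd].
exists d; split; [apply cond_pos|]; intros s [[Hs Hst] Hds]; simpl in *.
unfold Rdist in *.
rewrite (Hfg s Hs), (Hfg t Ht).
specialize (Hd (s - t)); replace (t + (s - t)) with s in Hd by ring.
apply Hd; lra.
Qed.

Lemma Derive_on_is_derive (a b : R) (f g : R -> R) (t l : R) :
  a < b -> Icc a b t -> (forall s, Icc a b s -> f s = g s) ->
  is_derive g t l -> Derive_on a b f t = l.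
Proof.
intros Hab Ht Hfg Hg; apply Derive_on_unique; try assumption.
now apply D_in_is_derive with g.
Qed.

Lemma C1_on_is_derive (a b : R) (f g g1 : R -> R) :
  a < b -> (forall s, Icc a b s -> f s = g s) ->
  (forall t, is_derive g t (g1 t)) -> (forall t, continuous g1 t) ->
  C1_on a b f.
Proof.
intros Hab Hfg Hg Hg1 t Ht; split.
- exists (g1 t); now apply D_in_is_derive with g.
- intros e He.
  destruct (proj2 (continuity_pt_filterlim _ _) (Hg1 t) e He) as [d [Hd Hd']].
  exists d; split; [exact Hd|]; intros s [[Hs Hst] Hds].
  rewrite (Derive_on_is_derive a b f g s (g1 s)) by auto.
  rewrite (Derive_on_is_derive a b f g t (g1 t)) by auto.
  apply Hd'; split; [split; [exact I | exact Hst] | exact Hds].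
Qed.

(** The derivative is frozen at its endpoint values outside the interval and integrated from [a],
    starting at [f a]. On the interval [f - g] has derivative zero and vanishes at [a], so it is
    zero by the mean value theorem. Ordinary two-sided derivatives become available in this way. *)
Lemma C1_on_extension (a b : R) (f : R -> R) :
  a < b -> C1_on a b f ->
  exists g g1 : R -> R,
    (forall t, is_derive g t (g1 t)) /\ (forall t, continuous g1 t) /\
    (forall t, Icc a b t -> f t = g t /\ Derive_on a b f t = g1 t).
Proof.
intros Hab Hf.
set (g1 := fun t => Derive_on a b f (clamp a b t)).
assert (Hg1 : forall t, continuous g1 t).
{ intros t; apply (continuous_clamp a b (Derive_on a b f)); [lra|].
  intros s Hs; now apply Hf. }
set (g := fun t => f a + RInt g1 a t).
assert (Hg : forall t, is_derive g t (g1 t)).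
{ intros t; unfold g.
  evar_last; [apply (is_derive_plus (fun _ => f a) (fun t => RInt g1 a t));
    [apply is_derive_const | apply (is_derive_RInt g1 _ a)]|].
  - apply filter_forall; intros s; apply (@RInt_correct R_CompleteNormedModule).
    apply (@ex_RInt_continuous R_CompleteNormedModule); auto.
  - apply Hg1.
  - apply plus_zero_l. }
exists g, g1; split; [exact Hg | split; [exact Hg1|]].
intros t Ht; split; [|unfold g1; now rewrite clamp_id].
(* Nothing is known of [f] outside the interval; clamping gives the two-sided continuity at the
   endpoints that [MVT_gen] asks for. *)
set (h := fun s => f (clamp a b s) - g s).
destruct (MVT_gen h a t (fun _ => 0)) as [x [_ Hx]].
- intros x; rewrite Rmin_left, Rmax_right by apply Ht; intros Hx.
  assert (Hx' : a < x < b) by (unfold Icc in Ht; lra).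
  assert (Hxi : Icc a b x) by (unfold Icc; lra).
  evar_last.
  + apply (is_derive_minus (fun s => f (clamp a b s)) g); [|apply Hg].
    apply is_derive_ext_loc with f.
    * assert (Hr : 0 < Rmin (x - a) (b - x)) by (apply Rmin_pos; lra).
      exists (mkposreal _ Hr); intros y Hy.
      pose proof (Rmin_l (x - a) (b - x)); pose proof (Rmin_r (x - a) (b - x)).
      assert (Hy' := Rabs_def2 _ _ Hy); simpl in Hy'.
      unfold minus, plus, opp in Hy'; simpl in Hy'.
      rewrite clamp_id; [reflexivity | unfold Icc; lra].
    * apply is_derive_D_in_interior with a b; [exact Hx'|].
      apply (Derive_on_correct a b f x Hab Hxi).
      now apply Hf.
  + unfold g1; rewrite clamp_id by exact Hxi.
    exact (minus_eq_zero (Derive_on a b f x)).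
- intros x _; apply continuity_pt_filterlim.
  apply (continuous_minus (fun s => f (clamp a b s)) g).
  + apply continuous_clamp; [lra|]; intros s Hs.
    apply cont_deriv with (Derive_on a b f), Derive_on_correct; auto.
    now apply Hf.
  + apply ex_derive_continuous; eexists; apply Hg.
- assert (Ha : h a = 0).
  { unfold h, g; rewrite clamp_id, RInt_point by (unfold Icc; lra).
    unfold zero; simpl; ring. }
  assert (h t = f t - g t) by (unfold h; now rewrite clamp_id).
  lra.
Qed.

(** An infinite least upper bound would be sent to the default value 0 by [real]. The bound [M]
    excludes [p_infty] and the value at [a] excludes [m_infty]. *)
Lemma sup_norm_bounds (a b M : R) (f : R -> R) :
  a <= b -> (forall t, Icc a b t -> Rabs (f t) <= M) ->
  sup_norm a b f <= M /\ forall t, Icc a b t -> Rabs (f t) <= sup_norm a b f.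
Proof.
intros Hab HM; unfold sup_norm.
set (E := fun y => exists t, Icc a b t /\ y = Rabs (f t)).
destruct (Lub_Rbar_correct E) as [Hub Hlub].
assert (HE : Rbar_le (Lub_Rbar E) M).
{ apply Hlub; intros y [t [Ht ->]]; now apply HM. }
assert (Ha : E (Rabs (f a))) by (exists a; unfold Icc; split; [lra | reflexivity]).
assert (Ha' := Hub _ Ha).
assert (Hle : forall t, Icc a b t -> Rbar_le (Rabs (f t)) (Lub_Rbar E))
  by (intros t Ht; apply Hub; now exists t).
destruct (Lub_Rbar E) as [l| |]; simpl in *; try easy.
Qed.

(** * From a negative second variation to a decrease of the action *)

Lemma decrease_of_second_derivative_neg (A A1 : R -> R) (d : R) :
  (forall s, is_derive A s (A1 s)) -> is_derive A1 0 d -> A1 0 = 0 -> d < 0 ->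
  exists r, 0 < r /\ forall s, 0 < s < r -> A s < A 0.
Proof.
intros HA HA1 H0 Hd.
apply is_derive_Reals in HA1.
(* With tolerance [- d], the quotient [A1 x / x] stays within [- d] of [d], hence is negative. *)
destruct (HA1 (- d) ltac:(lra)) as [r Hr].
exists r; split; [apply cond_pos|]; intros s Hs.
destruct (MVT_cor2 A A1 0 s (proj1 Hs)) as [x [Hx Hx']].
{ intros x _; apply is_derive_Reals, HA. }
specialize (Hr x ltac:(lra)); rewrite Rabs_right in Hr by lra.
specialize (Hr ltac:(lra)).
rewrite Rplus_0_l, H0, Rminus_0_r in Hr.
assert (Hq : A1 x / x < 0) by (assert (Hr' := Rabs_def2 _ _ Hr); lra).
assert (E : A1 x = A1 x / x * x) by (field; lra).
assert (A1 x < 0) by (rewrite E; nra).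
nra.
Qed.

Lemma is_derive_RInt_parameter (F F1 : R -> R -> R) (a b s : R) :
  (forall s t, continuity_2d_pt F s t) ->
  (forall s t, continuity_2d_pt F1 s t) ->
  (forall s t, is_derive (fun s => F s t) s (F1 s t)) ->
  is_derive (fun s => RInt (F s) a b) s (RInt (F1 s) a b).
Proof.
intros HF HF1 HD.
assert (HE : forall s t, Derive (fun s => F s t) s = F1 s t)
  by (intros r t; apply is_derive_unique, HD).
evar_last.
- apply (is_derive_RInt_param F).
  + apply filter_forall; intros r t _; eexists; apply HD.
  + intros t _; apply continuity_2d_pt_ext with (2 := HF1 s t).
    intros x y; symmetry; apply HE.
  + apply filter_forall; intros r.
    apply (@ex_RInt_continuous R_CompleteNormedModule); intros t _.
    apply continuity_pt_filterlim; intros e He.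
    destruct (HF r t (mkposreal e He)) as [d Hd].
    exists d; split; [apply cond_pos|]; intros t' [_ Ht'].
    apply Hd; [rewrite Rminus_diag, Rabs_R0; apply cond_pos | exact Ht'].
- apply RInt_ext; intros t _; apply HE.
Qed.

Lemma is_derive_cosh (x : R) : is_derive cosh x (sinh x).
Proof. apply is_derive_Reals, derivable_pt_lim_cosh. Qed.

Lemma is_derive_sinh (x : R) : is_derive sinh x (cosh x).
Proof. apply is_derive_Reals, derivable_pt_lim_sinh. Qed.

Lemma is_derive_continuity_pt (f : R -> R) (x l : R) :
  is_derive f x l -> continuity_pt f x.
Proof.
intros H; apply continuity_pt_filterlim.
apply (ex_derive_continuous f); now exists l.
Qed.

(** Differentiating twice under the integral sign, the two integral hypotheses say that the action
    along [X + s h] has first derivative zero and negative second derivative at [s = 0]. *)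
Lemma second_variation_decrease (m a b : R) (V X X1 h h1 : R -> R) :
  C2 V ->
  (forall t, continuous X t) -> (forall t, continuous X1 t) ->
  (forall t, continuous h t) -> (forall t, continuous h1 t) ->
  RInt (fun t => m * sinh (X1 t) * h1 t - Derive V (X t) * h t) a b = 0 ->
  RInt (fun t => m * cosh (X1 t) * (h1 t)^2
                 - Derive (Derive V) (X t) * (h t)^2) a b < 0 ->
  exists r, 0 < r /\ forall s, 0 < s < r ->
    RInt (fun t => m * (cosh (X1 t + s * h1 t) - 1) - V (X t + s * h t)) a b
    < RInt (fun t => m * (cosh (X1 t) - 1) - V (X t)) a b.
Proof.
intros HV HX HX1 Hh Hh1 HQ1 HQ2.
set (F := fun s t => m * (cosh (X1 t + s * h1 t) - 1) - V (X t + s * h t)).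
(* [F1] and [F2] are the first two partial derivatives of [F] in [s]. All three are jointly
   continuous because [V] is of class C2. *)
set (F1 := fun s t => m * sinh (X1 t + s * h1 t) * h1 t
                      - Derive V (X t + s * h t) * h t).
set (F2 := fun s t => m * cosh (X1 t + s * h1 t) * (h1 t * h1 t)
                      - Derive (Derive V) (X t + s * h t) * (h t * h t)).
assert (c1 : forall f : R -> R, (forall t, continuous f t) ->
  forall s t, continuity_2d_pt (fun _ t => f t) s t).
{ intros f Hf s t.
  apply (continuity_1d_2d_pt_comp f (fun _ v => v)).
  - now apply continuity_pt_filterlim, Hf.
  - apply continuity_2d_pt_id2. }
assert (c2 : forall (g f f1 : R -> R), (forall x, continuity_pt g x) ->
  (forall t, continuous f t) -> (forall t, continuous f1 t) ->
  forall s t, continuity_2d_pt (fun s t => g (f t + s * f1 t)) s t).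
{ intros g f f1 Hg Hf Hf1 s t.
  apply (continuity_1d_2d_pt_comp g (fun s t => f t + s * f1 t)); [apply Hg|].
  apply continuity_2d_pt_plus; [now apply c1|].
  apply continuity_2d_pt_mult; [apply continuity_2d_pt_id1 | now apply c1]. }
assert (Vd : forall x, is_derive V x (Derive V x))
  by (intros x; apply Derive_correct, HV).
assert (Vd' : forall x, is_derive (Derive V) x (Derive (Derive V) x))
  by (intros x; apply Derive_correct, HV).
assert (HF : forall s t, continuity_2d_pt F s t).
{ intros s t; apply continuity_2d_pt_minus.
  - apply continuity_2d_pt_mult; [apply continuity_2d_pt_const|].
    apply continuity_2d_pt_minus; [|apply continuity_2d_pt_const].
    apply (c2 cosh); auto; intros x.
    apply is_derive_continuity_pt with (1 := is_derive_cosh x).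
  - apply (c2 V); auto; intros x.
    apply is_derive_continuity_pt with (1 := Vd x). }
assert (HF1 : forall s t, continuity_2d_pt F1 s t).
{ intros s t; apply continuity_2d_pt_minus.
  - apply continuity_2d_pt_mult; [|now apply c1].
    apply continuity_2d_pt_mult; [apply continuity_2d_pt_const|].
    apply (c2 sinh); auto; intros x.
    apply is_derive_continuity_pt with (1 := is_derive_sinh x).
  - apply continuity_2d_pt_mult; [|now apply c1].
    apply (c2 (Derive V)); auto; intros x.
    apply is_derive_continuity_pt with (1 := Vd' x). }
assert (HF2 : forall s t, continuity_2d_pt F2 s t).
{ intros s t; apply continuity_2d_pt_minus.
  - apply continuity_2d_pt_mult;
      [|apply continuity_2d_pt_mult; now apply c1].
    apply continuity_2d_pt_mult; [apply continuity_2d_pt_const|].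
    apply (c2 cosh); auto; intros x.
    apply is_derive_continuity_pt with (1 := is_derive_cosh x).
  - apply continuity_2d_pt_mult;
      [|apply continuity_2d_pt_mult; now apply c1].
    apply (c2 (Derive (Derive V))); auto; intros x.
    apply continuity_pt_filterlim, HV. }
assert (dline : forall f f1 s : R, is_derive (fun s => f + s * f1) s f1)
  by (intros; auto_derive; [exact I | ring]).
assert (dcomp : forall (g g1 : R -> R) f f1 s,
  (forall x, is_derive g x (g1 x)) ->
  is_derive (fun s => g (f + s * f1)) s (f1 * g1 (f + s * f1))).
{ intros g g1 f f1 s Hg.
  apply (is_derive_comp g (fun s => f + s * f1)); [apply Hg | apply dline]. }
destruct (decrease_of_second_derivative_neg
  (fun s => RInt (F s) a b) (fun s => RInt (F1 s) a b) (RInt (F2 0) a b))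
  as [r [Hr Hdec]].
- intros s; apply is_derive_RInt_parameter; [exact HF | exact HF1|].
  intros x t; unfold F, F1; evar_last.
  + apply (is_derive_minus (fun s => m * (cosh (X1 t + s * h1 t) - 1))
      (fun s => V (X t + s * h t))); [|apply (dcomp V (Derive V)), Vd].
    apply (is_derive_scal (fun s => cosh (X1 t + s * h1 t) - 1)).
    apply (is_derive_minus (fun s => cosh (X1 t + s * h1 t)) (fun _ => 1));
      [apply (dcomp cosh sinh), is_derive_cosh | apply is_derive_const].
  + unfold minus, plus, opp, zero, scal; simpl; unfold mult; simpl; ring.
- apply is_derive_RInt_parameter; [exact HF1 | exact HF2|].
  intros x t; unfold F1, F2; evar_last.
  + apply (is_derive_minus (fun s => m * sinh (X1 t + s * h1 t) * h1 t)
      (fun s => Derive V (X t + s * h t) * h t));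
      apply (is_derive_scal_l (V := R_NormedModule)).
    * apply (is_derive_scal (fun s => sinh (X1 t + s * h1 t))).
      apply (dcomp sinh cosh), is_derive_sinh.
    * apply (dcomp (Derive V) (Derive (Derive V))), Vd'.
  + unfold minus, plus, opp, zero, scal; simpl; unfold mult; simpl; ring.
- refine (eq_trans _ HQ1); apply RInt_ext; intros t _; unfold F1.
  now rewrite !Rmult_0_l, !Rplus_0_r.
- replace (RInt (F2 0) a b) with
    (RInt (fun t => m * cosh (X1 t) * (h1 t)^2
       - Derive (Derive V) (X t) * (h t)^2) a b); [exact HQ2|].
  apply RInt_ext; intros t _; unfold F2.
  rewrite !Rmult_0_l, !Rplus_0_r; simpl; ring.
- exists r; split; [exact Hr|]; intros s Hs.
  apply Rlt_le_trans with (1 := Hdec s Hs); right.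
  apply RInt_ext; intros t _; unfold F.
  now rewrite !Rmult_0_l, !Rplus_0_r.
Qed.

(** * Estimates on compact intervals and uniqueness for the Jacobi equation *)

Lemma continuous_bounded (a b : R) (f : R -> R) :
  a <= b -> (forall t, Icc a b t -> continuous f t) ->
  exists M, 0 <= M /\ forall t, Icc a b t -> Rabs (f t) <= M.
Proof.
intros Hab Hf.
destruct (continuity_ab_maj (fun t => Rabs (f t)) a b Hab) as [x [Hx _]].
- intros t Ht; apply continuity_pt_filterlim.
  apply continuous_comp; [now apply Hf | apply continuous_Rabs].
- exists (Rabs (f x)); split; [apply Rabs_pos | exact Hx].
Qed.

(** Mean value theorem with a bound on [f1]. It measures how fast quantities approach their value at
    the corner [c]. *)
Lemma is_derive_lipschitz (a c : R) (f f1 : R -> R) :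
  a <= c -> (forall t, Icc a c t -> is_derive f t (f1 t)) ->
  (forall t, Icc a c t -> continuous f1 t) ->
  exists M, 0 <= M /\ forall t, Icc a c t -> Rabs (f t - f c) <= M * (c - t).
Proof.
intros Hac Hf Hf1.
destruct (continuous_bounded a c f1 Hac Hf1) as [M [HM Hb]].
exists M; split; [exact HM|]; intros t [Hat Htc].
destruct Htc as [Htc | ->];
  [|rewrite Rminus_diag, Rabs_R0; apply Rmult_le_pos; lra].
destruct (MVT_cor2 f f1 t c Htc) as [x [Hx Hx']].
- intros x Hx; apply is_derive_Reals, Hf; unfold Icc; lra.
- rewrite Rabs_minus_sym, Hx, Rabs_mult, (Rabs_right (c - t)) by lra.
  apply Rmult_le_compat_r; [lra|]; apply Hb; unfold Icc; lra.
Qed.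

(** The mean value theorem is applied to [G] minus the primitive of [f], so that [G1] itself is
    never integrated. *)
Lemma RInt_le_primitive (a b : R) (f G G1 : R -> R) :
  a < b -> (forall t, continuous f t) ->
  (forall t, Icc a b t -> is_derive G t (G1 t) /\ f t <= G1 t) ->
  RInt f a b <= G b - G a.
Proof.
intros Hab Hf HG.
destruct (MVT_cor2 (fun t => G t - RInt f a t) (fun t => G1 t - f t) a b Hab)
  as [x [Hx Hx']].
- intros t Ht; apply is_derive_Reals.
  apply (is_derive_minus G (fun t => RInt f a t)); [now apply HG|].
  apply (is_derive_RInt f _ a); [|apply Hf].
  apply filter_forall; intros s; apply (@RInt_correct R_CompleteNormedModule).
  apply (@ex_RInt_continuous R_CompleteNormedModule); auto.
- rewrite (RInt_point a f) in Hx; unfold zero in Hx; simpl in Hx.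
  assert (f x <= G1 x) by (apply HG; unfold Icc; lra).
  assert (0 <= (G1 x - f x) * (b - a)) by (apply Rmult_le_pos; lra).
  lra.
Qed.

(** Gronwall on both sides of [c]: to the right [E t * exp (- K * t)] does not increase from its
    value 0, and to the left [E t * exp (K * t)] does not decrease towards it. *)
Lemma gronwall_zero (a b c K : R) (E E1 : R -> R) :
  Icc a b c -> (forall t, Icc a b t -> is_derive E t (E1 t)) ->
  (forall t, Icc a b t -> Rabs (E1 t) <= K * E t) -> E c = 0 ->
  forall t, Icc a b t -> E t <= 0.
Proof.
intros Hc HE HK Hc0 t Ht.
assert (Hd : forall k x, Icc a b x ->
  is_derive (fun t => E t * exp (k * t)) x ((E1 x + k * E x) * exp (k * x))).
{ intros k x Hx; evar_last.
  - apply (is_derive_mult E (fun t => exp (k * t)));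
      [now apply HE | | apply Rmult_comm].
    apply is_derive_comp; [apply is_derive_exp|].
    apply (is_derive_scal (fun t => t)), is_derive_id.
  - unfold plus, mult, scal, one; simpl; unfold mult; simpl; ring. }
unfold Icc in *.
destruct (Rtotal_order c t) as [Hct | [-> | Hct]]; [|lra|].
- destruct (MVT_cor2 _ _ c t Hct
    (fun x Hx => proj1 (is_derive_Reals _ _ _) (Hd (- K) x ltac:(lra))))
    as [x [Hx Hx']].
  assert (Hx2 : a <= x <= b) by lra.
  specialize (HK x Hx2); apply Rabs_le_between in HK.
  rewrite Hc0 in Hx.
  pose proof (exp_pos (- K * x)); pose proof (exp_pos (- K * t)).
  assert ((E1 x + - K * E x) * exp (- K * x) <= 0) by nra.
  nra.
- destruct (MVT_cor2 _ _ t c Hct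
    (fun x Hx => proj1 (is_derive_Reals _ _ _) (Hd K x ltac:(lra))))
    as [x [Hx Hx']].
  assert (Hx2 : a <= x <= b) by lra.
  specialize (HK x Hx2); apply Rabs_le_between in HK.
  rewrite Hc0 in Hx.
  pose proof (exp_pos (K * x)); pose proof (exp_pos (K * t)).
  assert (0 <= (E1 x + K * E x) * exp (K * x)) by nra.
  nra.
Qed.

(** With [W = P Z] the equation is the system [U' = W / P], [W' = - q U]. The energy [U^2 + W^2] has
    derivative [2 U W (1 / P - q)], at most a constant times the energy in absolute value, so
    Gronwall applies. *)
Lemma sturm_liouville_unique (a b c : R) (P q U Z : R -> R) :
  Icc a b c ->
  (forall t, Icc a b t -> continuous P t /\ 0 < P t /\ continuous q t) ->
  (forall t, Icc a b t -> is_derive U t (Z t)) ->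
  (forall t, Icc a b t -> is_derive (fun s => P s * Z s) t (- (q t * U t))) ->
  U c = 0 -> Z c = 0 -> forall t, Icc a b t -> U t = 0.
Proof.
intros Hc HPq HU HW Uc Zc t Ht.
destruct (continuous_bounded a b (fun t => / P t - q t)) as [K [HK0 HK]].
- unfold Icc in Hc; lra.
- intros s Hs; destruct (HPq s Hs) as [HP [HP0 Hq]].
  apply (continuous_minus (fun t => / P t) q); [|exact Hq].
  apply continuous_comp; [exact HP|]; apply continuous_Rinv; lra.
- assert (HE : (U t)^2 + (P t * Z t)^2 <= 0); [|simpl in HE; nra].
  apply (gronwall_zero a b c K (fun t => (U t)^2 + (P t * Z t)^2)
    (fun t => 2 * (U t * (P t * Z t)) * (/ P t - q t))); auto.
  + intros s Hs; destruct (HPq s Hs) as [_ [HP0 _]].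
    evar_last.
    * apply (is_derive_plus (fun t => (U t)^2) (fun t => (P t * Z t)^2)).
      -- apply (is_derive_pow U 2); now apply HU.
      -- apply (is_derive_pow (fun t => P t * Z t) 2); now apply HW.
    * unfold plus; simpl; field; lra.
  + intros s Hs; rewrite Rabs_mult.
    rewrite (Rmult_comm K); apply Rmult_le_compat; try apply Rabs_pos.
    * apply Rabs_le_between.
      pose proof (pow2_ge_0 (U s - P s * Z s)).
      pose proof (pow2_ge_0 (U s + P s * Z s)); simpl in *; split; nra.
    * now apply HK.
  + rewrite Uc, Zc; ring.
Qed.

(** * Rounding the corner: a C1 direction of negative second variation *)

Lemma is_derive_continuous (f : R -> R) (x l : R) :
  is_derive f x l -> continuous f x.
Proof. intros H; apply (ex_derive_continuous f); now exists l. Qed.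

Lemma Rabs_mult_le (x y M N : R) :
  Rabs x <= M -> Rabs y <= N -> Rabs (x * y) <= M * N.
Proof.
intros Hx Hy; rewrite Rabs_mult.
apply Rmult_le_compat; auto using Rabs_pos.
Qed.

(** Meant for [t <= c] only; it has a pole at [t = c + e]. *)
Definition weight (c e t : R) : R := e / (c - t + e).

(** The last bound absorbs a factor [c - t] against one power of the weight at the price of [e];
    this makes the cost of rounding of order [e]. *)
Lemma weight_bounds (c e t : R) :
  0 < e -> t <= c ->
  0 < weight c e t <= 1 /\ (c - t) * weight c e t <= e.
Proof.
intros He Ht; unfold weight.
assert (Hd : 0 < c - t + e) by lra.
assert (Hw : e / (c - t + e) * (c - t + e) = e) by (field; lra).
assert (H0 : 0 < e / (c - t + e)) by now apply Rdiv_lt_0_compat.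
repeat split; [exact H0| |]; nra.
Qed.

Lemma is_derive_weight (c e t : R) :
  0 < e -> t <= c -> is_derive (weight c e) t (weight c e t ^ 2 / e).
Proof.
intros He Ht; unfold weight; auto_derive; [lra | field; lra].
Qed.

(** Here [K1] records the quadratic vanishing of [P U^2] at [c], and [- kappa] bounds the
    coefficient of the cross term at [c], up to an error linear in [c - t]. Rounding costs
    [4 (K1 + d K2) e], while the cross term contributes [- 2 d kappa], up to the factor
    [1 - w(a)^2]. *)
Lemma second_variation_rounded_corner
    (a b c e d : R) (P q U Z : R -> R) :
  a < c < b -> 0 < e -> 0 <= d ->
  (forall t, continuous P t) ->
  (forall t, continuous q t) ->
  (forall t, is_derive U t (Z t)) -> (forall t, continuous Z t) ->
  (forall t, Icc a b t -> is_derive (fun s => P s * Z s) t (- (q t * U t))) ->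
  U a = 0 -> U c = 0 ->
  forall (phi phi1 : R -> R) (K1 K2 kappa : R),
  (forall t, is_derive phi t (phi1 t)) -> (forall t, continuous phi1 t) ->
  phi a = 0 -> phi b = 0 -> 0 <= K1 -> 0 <= K2 ->
  (forall t, Icc a c t -> P t * (U t)^2 <= K1 * (c - t)^2) ->
  (forall t, Icc a c t ->
     P t * Z t * phi t - P t * U t * phi1 t <= - kappa + K2 * (c - t)) ->
  exists h h1 : R -> R,
    (forall t, is_derive h t (h1 t)) /\ (forall t, continuous h1 t) /\
    h a = 0 /\ h b = 0 /\
    RInt (fun t => P t * (h1 t)^2 - q t * (h t)^2) a b <=
      4 * (K1 + d * K2) * e - 2 * d * kappa * (1 - (weight c e a)^2)
      + d^2 * RInt (fun t => P t * (phi1 t)^2 - q t * (phi t)^2) a b.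
Proof.
intros Hc He Hd cP cq dU cZ dW Ua Uc phi phi1 K1 K2 kappa dphi cphi
  phia phib HK1 HK2 HU HG.
set (w := weight c e).
set (dw := fun t => w t ^ 2 / e).
assert (Hdw : forall t, t <= c -> is_derive w t (dw t))
  by (intros; now apply is_derive_weight).
assert (cU : forall t, continuous U t)
  by (intros t; apply is_derive_continuous with (1 := dU t)).
assert (cph : forall t, continuous phi t)
  by (intros t; apply is_derive_continuous with (1 := dphi t)).
(* The derivative of [U (1 - w^2)], using [w' = w^2 / e]. At [c] both terms vanish since [w c = 1]
   and [U c = 0]. *)
set (k0 := fun t => Z t * (1 - w t ^ 2) + U t * (- (2 * w t ^ 3 / e))).
assert (cw : forall t, t <= c -> continuous w t)
  by (intros t Ht; now apply is_derive_continuous with (dw t), Hdw).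
assert (dUth : forall t, t <= c ->
  is_derive (fun t => U t * (1 - w t ^ 2)) t (k0 t)).
{ intros t Ht; evar_last.
  - apply (is_derive_mult U (fun t => 1 - w t ^ 2));
      [apply dU | | apply Rmult_comm].
    apply (is_derive_minus (fun _ => 1) (fun t => w t ^ 2));
      [apply is_derive_const|].
    apply (is_derive_pow w 2); now apply Hdw.
  - unfold plus, mult, minus, plus, opp, zero, k0, dw; simpl;
      unfold mult; simpl; field; lra. }
assert (ck0 : forall t, t <= c -> continuous k0 t).
{ intros t Ht.
  assert (cpow : forall n, continuous (fun t => w t ^ n) t).
  { intros n; apply (ex_derive_continuous (fun t => w t ^ n)).
    apply (ex_derive_pow w n); eexists; now apply Hdw. }
  apply (continuous_plus (fun t => Z t * (1 - w t ^ 2))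
    (fun t => U t * (- (2 * w t ^ 3 / e)))).
  - apply (continuous_mult Z (fun t => 1 - w t ^ 2)); [apply cZ|].
    apply (continuous_minus (fun _ => 1) (fun t => w t ^ 2));
      [apply continuous_const | apply cpow].
  - apply (continuous_mult U (fun t => - (2 * w t ^ 3 / e))); [apply cU|].
    apply (continuous_opp (fun t => 2 * w t ^ 3 / e)).
    apply (continuous_mult (fun t => 2 * w t ^ 3) (fun _ => / e));
      [|apply continuous_const].
    apply (continuous_mult (fun _ => 2) (fun t => w t ^ 3));
      [apply continuous_const | apply cpow]. }
assert (k0c : k0 c = 0).
{ unfold k0, w, weight; rewrite Uc; field; lra. }
(* Past [c] the value is [k0 c = 0], so this is the continuous extension by zero, and the pole of
   the weight is never met. Its primitive [g] is then C1 across [c]. *)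
set (g1 := fun t => k0 (Rmin t c)).
assert (cg1 : forall t, continuous g1 t).
{ intros t; apply (continuous_comp (fun t => Rmin t c) k0);
    [|apply ck0, Rmin_r].
  apply (continuous_ext (fun t => (t + c - Rabs (t - c)) / 2)).
  - intros s; unfold Rmin, Rabs; destruct (Rle_dec _ _), (Rcase_abs _);
      simpl; lra.
  - apply (continuous_mult (fun t => t + c - Rabs (t - c)) (fun _ => / 2));
      [|apply continuous_const].
    apply (continuous_minus (fun t => t + c) (fun t => Rabs (t - c))).
    + apply (continuous_plus (fun t => t) (fun _ => c));
        [apply continuous_id | apply continuous_const].
    + apply (continuous_comp (fun t => t - c) Rabs); [|apply continuous_Rabs].
      apply (continuous_minus (fun t => t) (fun _ => c));
        [apply continuous_id | apply continuous_const]. }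
set (g := fun t => RInt g1 a t).
assert (eg1 : forall x y, ex_RInt g1 x y)
  by (intros x y; apply (@ex_RInt_continuous R_CompleteNormedModule); auto).
assert (dg : forall t, is_derive g t (g1 t)).
{ intros t; apply (is_derive_RInt g1 _ a); [|apply cg1].
  apply filter_forall; intros s; now apply (@RInt_correct R_CompleteNormedModule). }
assert (gl : forall t, Icc a c t -> g t = U t * (1 - w t ^ 2)).
{ intros t [Hat Htc]; unfold g; apply is_RInt_unique.
  replace (U t * (1 - w t ^ 2)) with
    (minus (U t * (1 - w t ^ 2)) (U a * (1 - w a ^ 2)))
    by (rewrite Ua; unfold minus, plus, opp; simpl; ring).
  apply is_RInt_ext with k0.
  - intros x; rewrite Rmin_left, Rmax_right by exact Hat; intros Hx.
    unfold g1; now rewrite Rmin_left by lra.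
  - apply (is_RInt_derive (fun t => U t * (1 - w t ^ 2)));
      intros x; rewrite Rmin_left, Rmax_right by exact Hat; intros Hx;
      [apply dUth | apply ck0]; lra. }
(* The integral up to [c] is [U c * (1 - w c ^ 2) = 0], and [g1] is zero from there on. *)
assert (gr : forall t, c <= t -> g t = 0).
{ intros t Ht; unfold g.
  rewrite <- (RInt_Chasles g1 a c t) by auto.
  change (g c + RInt g1 c t = 0).
  rewrite gl by (unfold Icc; lra); rewrite Uc.
  rewrite (RInt_ext g1 (fun _ => 0)).
  - rewrite RInt_const; unfold scal; simpl; unfold mult; simpl; ring.
  - intros x; rewrite Rmin_left, Rmax_right by exact Ht; intros Hx.
    unfold g1; rewrite Rmin_right by lra; exact k0c. }
exists (fun t => g t + d * phi t), (fun t => g1 t + d * phi1 t).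
split; [|split; [|split; [|split]]].
- intros t; apply (is_derive_plus g (fun t => d * phi t)); [apply dg|].
  apply (is_derive_scal phi), dphi.
- intros t; apply (continuous_plus g1 (fun t => d * phi1 t)); [apply cg1|].
  apply (continuous_scal_r d phi1), cphi.
- rewrite gl, Ua, phia by (unfold Icc; lra); ring.
- rewrite gr, phib by lra; ring.
- set (psi := fun t => P t * (phi1 t)^2 - q t * (phi t)^2).
  set (f := fun t => P t * (g1 t + d * phi1 t)^2 - q t * (g t + d * phi t)^2).
  assert (cquad : forall x y, (forall t, continuous x t) ->
    (forall t, continuous y t) ->
    forall t, continuous (fun t => P t * (x t)^2 - q t * (y t)^2) t).
  { intros x y cx cy t.
    apply (continuous_minus (fun t => P t * (x t)^2) (fun t => q t * (y t)^2)).
    - apply (continuous_mult P (fun t => x t ^ 2)); [apply cP|].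
      apply (continuous_comp x (fun y => y ^ 2)); [apply cx|].
      apply (ex_derive_continuous (fun y => y ^ 2)); auto_derive; exact I.
    - apply (continuous_mult q (fun t => y t ^ 2)); [apply cq|].
      apply (continuous_comp y (fun y => y ^ 2)); [apply cy|].
      apply (ex_derive_continuous (fun y => y ^ 2)); auto_derive; exact I. }
  assert (cpsi : forall t, continuous psi t) by now apply cquad.
  assert (cf : forall t, continuous f t).
  { apply cquad; intros t.
    - apply (continuous_plus g1 (fun t => d * phi1 t)); [apply cg1|].
      apply (continuous_scal_r d phi1), cphi.
    - apply (continuous_plus g (fun t => d * phi t)).
      + apply is_derive_continuous with (1 := dg t).
      + apply (continuous_scal_r d phi), cph. }
  assert (ex : forall f x y, (forall t, continuous f t) -> ex_RInt f x y)
    by (intros; apply (@ex_RInt_continuous R_CompleteNormedModule); auto).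
  (* Past [c] the direction is just [d phi], so removing its contribution leaves a remainder carried
     by [[a, c]]. *)
  set (r := fun t => f t - d^2 * psi t).
  assert (cr : forall t, continuous r t).
  { intros t; apply (continuous_minus f (fun t => d^2 * psi t)); [apply cf|].
    apply (continuous_scal_r (d^2) psi), cpsi. }
  assert (Hsplit : RInt f a b = RInt r a c + d^2 * RInt psi a b :> R).
  { replace (RInt r a c) with (RInt r a b).
    - assert (Hs : RInt (fun t => d^2 * psi t) a b = d^2 * RInt psi a b)
        by exact (RInt_scal psi a b (d^2) (ex psi a b cpsi)).
      assert (Hm : RInt r a b = RInt f a b - RInt (fun t => d^2 * psi t) a b).
      { apply (RInt_minus f (fun t => d^2 * psi t)); apply ex; [exact cf|].
        intros t; apply (continuous_scal_r (d^2) psi), cpsi. }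
      rewrite Hm, Hs; symmetry; ring.
    - rewrite <- (RInt_Chasles r a c b) by auto.
      rewrite (RInt_ext r (fun _ => 0) c b).
      + rewrite RInt_const; unfold scal; simpl; unfold mult; simpl.
        rewrite Rmult_0_r; exact (plus_zero_r (RInt r a c)).
      + intros x; rewrite Rmin_left, Rmax_right by lra; intros Hx.
        change (r x = 0 :> R); unfold r, f, psi; rewrite gr by lra.
        unfold g1; rewrite Rmin_right, k0c by lra; ring. }
  rewrite Hsplit; apply Rplus_le_compat_r.
  (* [Phi'] bounds the integrand: the boundary term of the identity in the header,
     plus primitives of the bounds on the [th'] terms, as [w' = w^2 / e]. *)
  set (Phi := fun t =>
    P t * Z t * (U t * (1 - w t ^ 2) * (1 - w t ^ 2)
                 + 2 * d * (phi t * (1 - w t ^ 2)))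
    + (4 * (K1 + d * K2) * e * w t - 2 * d * kappa * w t ^ 2)).
  assert (w1 : w c = 1) by (unfold w, weight; field; lra).
  assert (wa : 0 < w a) by (apply (weight_bounds c e a He); lra).
  apply Rle_trans with (Phi c - Phi a).
  + apply RInt_le_primitive with
      (fun t => - (q t * U t) * (U t * (1 - w t ^ 2) * (1 - w t ^ 2)
                 + 2 * d * (phi t * (1 - w t ^ 2)))
        + P t * Z t * (k0 t * (1 - w t ^ 2)
            + U t * (1 - w t ^ 2) * (- (2 * w t ^ 3 / e))
            + 2 * d * (phi1 t * (1 - w t ^ 2) + phi t * (- (2 * w t ^ 3 / e))))
        + (4 * (K1 + d * K2) * w t ^ 2 - 4 * d * kappa * (w t ^ 3 / e)));
      [lra | exact cr |].
    intros t Ht; split.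
    * assert (Htc : t <= c) by apply Ht.
      assert (dth : is_derive (fun t => 1 - w t ^ 2) t (- (2 * w t ^ 3 / e))).
      { evar_last.
        - apply (is_derive_minus (fun _ => 1) (fun t => w t ^ 2));
            [apply is_derive_const|].
          apply (is_derive_pow w 2); now apply Hdw.
        - unfold minus, plus, opp, zero, dw; simpl; field; lra. }
      evar_last.
      -- apply (is_derive_plus (fun t => P t * Z t *
           (U t * (1 - w t ^ 2) * (1 - w t ^ 2)
                 + 2 * d * (phi t * (1 - w t ^ 2))))
           (fun t => 4 * (K1 + d * K2) * e * w t - 2 * d * kappa * w t ^ 2)).
         ++ apply (is_derive_mult (fun t => P t * Z t) (fun t =>
              U t * (1 - w t ^ 2) * (1 - w t ^ 2)
                 + 2 * d * (phi t * (1 - w t ^ 2))));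
              [apply dW; unfold Icc in *; lra | | apply Rmult_comm].
            apply (is_derive_plus
              (fun t => U t * (1 - w t ^ 2) * (1 - w t ^ 2))
              (fun t => 2 * d * (phi t * (1 - w t ^ 2)))).
            ** apply (is_derive_mult (fun t => U t * (1 - w t ^ 2))
                 (fun t => 1 - w t ^ 2));
                 [now apply dUth | exact dth | apply Rmult_comm].
            ** apply (is_derive_scal (fun t => phi t * (1 - w t ^ 2))).
               apply (is_derive_mult phi (fun t => 1 - w t ^ 2));
                 [apply dphi | exact dth | apply Rmult_comm].
         ++ apply (is_derive_minus (fun t => 4 * (K1 + d * K2) * e * w t)
              (fun t => 2 * d * kappa * w t ^ 2)).
            ** apply (is_derive_scal w); now apply Hdw.
            ** apply (is_derive_scal (fun t => w t ^ 2)).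
               apply (is_derive_pow w 2); now apply Hdw.
      -- unfold minus, plus, opp, dw, mult; simpl; field; lra.
    * destruct (weight_bounds c e t He (proj2 Ht)) as [[w0 w1'] sw].
      fold w in w0, w1', sw.
      specialize (HU t Ht); specialize (HG t Ht).
      unfold r, f, psi; rewrite (gl t Ht).
      replace (g1 t) with (k0 t)
        by (unfold g1; now rewrite Rmin_left by apply Ht).
      destruct Ht as [Hat Htc].
      unfold k0; set (y := w t) in *; clearbody y.
      (* The term [P U^2 th'^2], with [th' = - 2 w^3 / e]. The bound is the derivative of
         [4 K1 e w]. *)
      assert (HA : P t * (U t)^2 * (4 * y^6 / e^2) <= 4 * K1 * y^2).
      { apply Rle_trans with (K1 * (c - t)^2 * (4 * y^6 / e^2)).
        - apply Rmult_le_compat_r; [|exact HU].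
          apply Rlt_le, Rdiv_lt_0_compat; [|apply pow_lt, He].
          apply Rmult_lt_0_compat; [lra | now apply pow_lt].
        - replace (K1 * (c - t)^2 * (4 * y^6 / e^2))
            with (4 * K1 * y^2 * (((c - t) * y / e)^2 * y^2)) by (field; lra).
          rewrite <- (Rmult_1_r (4 * K1 * y^2)) at 2.
          apply Rmult_le_compat_l.
          + apply Rmult_le_pos; [lra | apply pow2_ge_0].
          + assert (0 <= (c - t) * y / e <= 1).
            { split; [apply Rdiv_le_0_compat; nra|].
              apply Rle_div_l; lra. }
            assert (((c - t) * y / e)^2 <= 1) by (simpl; nra).
            assert (y^2 <= 1) by (simpl; nra).
            pose proof (pow2_ge_0 y); pose proof (pow2_ge_0 ((c - t) * y / e)).
            nra. }
      (* The cross term [2 d th' (P U phi' - W phi)]. The bound is the derivative of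
         [4 d K2 e w - 2 d kappa w^2]. *)
      assert (HB : 4 * d * (y^3 / e) *
          (P t * Z t * phi t - P t * U t * phi1 t)
        <= 4 * d * K2 * y^2 - 4 * d * kappa * (y^3 / e)).
      { apply Rle_trans with
          (4 * d * (y^3 / e) * (- kappa + K2 * (c - t))).
        - apply Rmult_le_compat_l; [|exact HG].
          apply Rmult_le_pos; [lra|].
          apply Rlt_le, Rdiv_lt_0_compat; [now apply pow_lt | exact He].
        - replace (4 * d * (y^3 / e) * (- kappa + K2 * (c - t)))
            with (4 * d * K2 * y^2 * ((c - t) * y / e)
                  - 4 * d * kappa * (y^3 / e)) by (field; lra).
          apply Rplus_le_compat_r.
          rewrite <- (Rmult_1_r (4 * d * K2 * y^2)) at 2.
          apply Rmult_le_compat_l.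
          + assert (0 <= d * K2) by now apply Rmult_le_pos.
            pose proof (pow2_ge_0 y); nra.
          + apply Rle_div_l; lra. }
      (* By the product identity all other terms cancel: integrand minus [Phi'] is the sum of the
         differences between the two sides in [HA] and in [HB]. *)
      match goal with |- ?l <= ?r0 =>
        assert (Hid : l - r0 =
          (P t * (U t)^2 * (4 * y^6 / e^2) - 4 * K1 * y^2)
          + (4 * d * (y^3 / e) * (P t * Z t * phi t - P t * U t * phi1 t)
             - (4 * d * K2 * y^2 - 4 * d * kappa * (y^3 / e)))) by (field; lra)
      end.
      lra.
  (* The part of [Phi] carrying [P Z] vanishes at [c] because [U c = 0] and [w c = 1], and at [a]
     because [U a = 0] and [phi a = 0]. Of the rest, only the nonnegative [4 (K1 + d K2) e w(a)] is
     dropped. *)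
  + unfold Phi; rewrite Uc, Ua, phia, w1.
    assert (0 <= 4 * (K1 + d * K2) * e * w a); [|fold w; simpl; nra].
    apply Rmult_le_pos; [|lra].
    apply Rmult_le_pos; [|lra].
    assert (0 <= d * K2) by now apply Rmult_le_pos.
    lra.
Qed.

Lemma negative_second_variation (a b c : R) (P q U Z : R -> R) :
  a < c < b ->
  (forall t, continuous P t) -> (forall t, 0 < P t) ->
  (forall t, continuous q t) ->
  (forall t, is_derive U t (Z t)) -> (forall t, continuous Z t) ->
  (forall t, Icc a b t -> is_derive (fun s => P s * Z s) t (- (q t * U t))) ->
  U a = 0 -> U c = 0 -> Z c <> 0 ->
  exists h h1 : R -> R,
    (forall t, is_derive h t (h1 t)) /\ (forall t, continuous h1 t) /\
    h a = 0 /\ h b = 0 /\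
    RInt (fun t => P t * (h1 t)^2 - q t * (h t)^2) a b < 0.
Proof.
intros Hc cP P0 cq dU cZ dW Ua Uc Zc.
(* Zero at both endpoints and of sign opposite to [Z c] at [c], so that [P Z phi] equals
   [- kappa < 0] there. *)
set (phi := fun t => - Z c * ((t - a) * (b - t))).
set (phi1 := fun t => - Z c * (a + b - 2 * t)).
assert (dphi : forall t, is_derive phi t (phi1 t))
  by (intros t; unfold phi, phi1; auto_derive; [exact I | ring]).
assert (cphi1 : forall t, continuous phi1 t).
{ intros t; apply is_derive_continuous with (- Z c * (- 2)).
  unfold phi1; auto_derive; [exact I | ring]. }
assert (cU : forall t, continuous U t)
  by (intros t; apply is_derive_continuous with (1 := dU t)).
assert (cphi : forall t, continuous phi t)
  by (intros t; apply is_derive_continuous with (1 := dphi t)).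
set (kappa := P c * (Z c)^2 * ((c - a) * (b - c))).
assert (Hk : 0 < kappa).
{ apply Rmult_lt_0_compat; [|apply Rmult_lt_0_compat; lra].
  apply Rmult_lt_0_compat; [apply P0 | now apply pow2_gt_0]. }
assert (Hac : a <= c) by lra.
destruct (continuous_bounded a c P Hac (fun t _ => cP t)) as [MP [MP0 HMP]].
destruct (continuous_bounded a c phi1 Hac (fun t _ => cphi1 t)) as [M1 [M10 HM1]].
destruct (is_derive_lipschitz a c U Z Hac (fun t _ => dU t) (fun t _ => cZ t))
  as [MU [MU0 HMU]].
destruct (is_derive_lipschitz a c (fun t => P t * Z t * phi t)
  (fun t => - (q t * U t) * phi t + P t * Z t * phi1 t) Hac) as [MW [MW0 HMW]].
{ intros t Ht; apply (is_derive_mult (fun t => P t * Z t) phi);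
    [apply dW; unfold Icc in *; lra | apply dphi | apply Rmult_comm]. }
{ intros t _.
  apply (continuous_plus (fun t => - (q t * U t) * phi t)
    (fun t => P t * Z t * phi1 t)).
  - apply (continuous_mult (fun t => - (q t * U t)) phi); [|apply cphi].
    apply (continuous_opp (fun t => q t * U t)).
    now apply (continuous_mult q U).
  - apply (continuous_mult (fun t => P t * Z t) phi1); [|apply cphi1].
    now apply (continuous_mult P Z). }
assert (HU : forall t, Icc a c t -> Rabs (U t) <= MU * (c - t)).
{ intros t Ht; rewrite <- (Rminus_0_r (U t)), <- Uc; now apply HMU. }
set (K1 := MP * MU^2).
set (K2 := MW + MP * MU * M1).
assert (HK1 : 0 <= K1) by (apply Rmult_le_pos; [exact MP0 | apply pow2_ge_0]).
assert (HK2 : 0 <= K2)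
  by (apply Rplus_le_le_0_compat; [exact MW0 | repeat apply Rmult_le_pos; lra]).
set (J := RInt (fun t => P t * (phi1 t)^2 - q t * (phi t)^2) a b : R).
(* Chosen so that [d^2 J <= d kappa]: the quadratic term uses up at most half of the gain
   [2 d kappa]. *)
set (d := kappa / (Rabs J + 1)).
assert (HJ := Rabs_pos J).
assert (Hd : 0 < d) by (apply Rdiv_lt_0_compat; lra).
(* Total coefficient of [e]: the rounding cost, and the loss [2 d kappa w(a)^2] with
   [w(a)^2 <= w(a) <= e / (c - a)]. The choice of [e] below gives [C e < d kappa], within the other
   half of the gain. *)
set (C := 4 * (K1 + d * K2) + 2 * d * kappa / (c - a)).
assert (HdK := Rmult_le_pos d K2 (Rlt_le _ _ Hd) HK2).
assert (Hdk := Rmult_lt_0_compat d kappa Hd Hk).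
assert (HC : 0 <= C).
{ apply Rplus_le_le_0_compat; [lra|].
  apply Rdiv_le_0_compat; lra. }
set (e := d * kappa / (C + 1)).
assert (He : 0 < e) by (apply Rdiv_lt_0_compat; lra).
destruct (second_variation_rounded_corner a b c e d P q U Z Hc He
  (Rlt_le _ _ Hd) cP cq dU cZ dW Ua Uc phi phi1 K1 K2 kappa)
  as [h [h1 [Hh [Hh1 [ha [hb HQ]]]]]]; try assumption.
- unfold phi; ring.
- unfold phi; ring.
- intros t Ht.
  specialize (HMP t Ht); rewrite Rabs_right in HMP by (left; apply P0).
  replace (K1 * (c - t)^2) with (MP * (MU * (c - t))^2) by (unfold K1; ring).
  apply Rmult_le_compat; [left; apply P0 | apply pow2_ge_0 | exact HMP |].
  now apply pow_maj_Rabs, HU.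
- intros t Ht.
  assert (H1 := proj1 (Rabs_le_between _ _) (HMW t Ht)).
  assert (H2 : Rabs (P t * U t * phi1 t) <= MP * (MU * (c - t)) * M1)
    by (apply Rabs_mult_le; [apply Rabs_mult_le|]; auto).
  apply Rabs_le_between in H2.
  assert (H3 : P c * Z c * phi c = - kappa) by (unfold phi, kappa; ring).
  rewrite H3 in H1.
  replace (K2 * (c - t)) with (MW * (c - t) + MP * (MU * (c - t)) * M1)
    by (unfold K2; ring).
  lra.
- exists h, h1; repeat (split; [assumption|]).
  apply Rle_lt_trans with (1 := HQ); fold J.
  destruct (weight_bounds c e a He Hac) as [[w0 w1] sw].
  set (w := weight c e a) in *; clearbody w.
  assert (Hw : w^2 <= e / (c - a)).
  { apply Rle_trans with w; [simpl; nra|].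
    apply Rle_div_r; lra. }
  assert (HeC : C * e < d * kappa).
  { replace (d * kappa) with ((C + 1) * e) by (unfold e; field; lra); lra. }
  assert (HdJ : d^2 * J <= d * kappa).
  { replace (d^2 * J) with (d * (d * J)) by ring.
    apply Rmult_le_compat_l; [lra|].
    replace kappa with (d * (Rabs J + 1)) by (unfold d; field; lra).
    apply Rmult_le_compat_l; [lra|]; pose proof (Rle_abs J); lra. }
  assert (Hdw : 2 * d * kappa * w^2 <= 2 * d * kappa * (e / (c - a)))
    by (apply Rmult_le_compat_l; lra).
  replace (C * e) with
    (4 * (K1 + d * K2) * e + 2 * d * kappa * (e / (c - a))) in HeC
    by (unfold C; field; lra).
  lra.
Qed.

(** * C2 extensions, the first variation, and the conclusion *)

(** The extension is the primitive of [g1], a C1 extension of the derivative of [f]. The separate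
    extension [F] of [f] has derivative equal to [g1] on the interval, which identifies the
    primitive with [f] there. *)
Lemma C2_on_extension (a b : R) (f : R -> R) :
  a < b -> C2_on a b f ->
  exists g g1 g2 : R -> R,
    (forall t, is_derive g t (g1 t)) /\ (forall t, is_derive g1 t (g2 t)) /\
    (forall t, continuous g2 t) /\
    (forall t, Icc a b t -> f t = g t /\ Derive_on a b f t = g1 t /\
       Derive_on a b (Derive_on a b f) t = g2 t).
Proof.
intros Hab [Hf Hf1].
destruct (C1_on_extension a b f Hab Hf) as [F [F1 [dF [cF1 EF]]]].
destruct (C1_on_extension a b _ Hab Hf1) as [g1 [g2 [dg1 [cg2 Eg]]]].
assert (cg1 : forall t, continuous g1 t)
  by (intros t; apply is_derive_continuous with (1 := dg1 t)).
exists (fun t => F a + RInt g1 a t), g1, g2.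
split; [|split; [exact dg1 | split; [exact cg2|]]].
- intros t; evar_last.
  + apply (is_derive_plus (fun _ => F a) (fun t => RInt g1 a t));
      [apply is_derive_const | apply (is_derive_RInt g1 _ a)]; [|apply cg1].
    apply filter_forall; intros s; apply (@RInt_correct R_CompleteNormedModule).
    apply (@ex_RInt_continuous R_CompleteNormedModule); auto.
  + apply plus_zero_l.
- intros t Ht; split; [|now apply Eg].
  assert (HR : is_RInt F1 a t (minus (F t) (F a)))
    by (apply (is_RInt_derive F F1); auto).
  rewrite (RInt_ext g1 F1), (is_RInt_unique _ _ _ _ HR).
  + rewrite (proj1 (EF t Ht)); unfold minus, plus, opp; simpl; ring.
  + intros x; rewrite Rmin_left, Rmax_right by apply Ht; intros Hx.
    assert (Hxi : Icc a b x) by (unfold Icc in *; lra).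
    rewrite <- (proj2 (EF x Hxi)); symmetry; now apply Eg.
Qed.

Lemma cosh_pos (x : R) : 0 < cosh x.
Proof.
unfold cosh; pose proof (exp_pos x); pose proof (exp_pos (- x)); lra.
Qed.

Lemma continuous_cosh (f : R -> R) (t : R) :
  continuous f t -> continuous (fun t => cosh (f t)) t.
Proof.
intros Hf; apply (continuous_comp f cosh); [exact Hf|].
apply is_derive_continuous with (1 := is_derive_cosh _).
Qed.

(** Integration by parts: under the Euler-Lagrange equation the integrand is the derivative of
    [m sinh(X1) h], which vanishes at both endpoints. *)
Lemma first_variation_zero (a b m : R) (V X X1 X2 h h1 : R -> R) :
  a < b -> C2 V ->
  (forall t, is_derive X t (X1 t)) -> (forall t, is_derive X1 t (X2 t)) ->
  (forall t, continuous X2 t) ->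
  (forall t, Icc a b t -> m * cosh (X1 t) * X2 t + Derive V (X t) = 0) ->
  (forall t, is_derive h t (h1 t)) -> (forall t, continuous h1 t) ->
  h a = 0 -> h b = 0 ->
  RInt (fun t => m * sinh (X1 t) * h1 t - Derive V (X t) * h t) a b = 0.
Proof.
intros Hab HV dX dX1 cX2 HEL dh ch1 ha hb.
set (G := fun t => m * sinh (X1 t) * h t).
set (G1 := fun t => m * (X2 t * cosh (X1 t)) * h t + m * sinh (X1 t) * h1 t).
assert (cX1 : forall t, continuous X1 t)
  by (intros t; apply is_derive_continuous with (1 := dX1 t)).
assert (dsinh : forall t,
  is_derive (fun t => m * sinh (X1 t)) t (m * (X2 t * cosh (X1 t)))).
{ intros t; apply (is_derive_scal (fun t => sinh (X1 t))).
  apply (is_derive_comp sinh X1); [apply is_derive_sinh | apply dX1]. }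
assert (HI : is_RInt G1 a b (minus (G b) (G a))).
{ apply (is_RInt_derive G G1).
  - intros t _; apply (is_derive_mult (fun t => m * sinh (X1 t)) h);
      [apply dsinh | apply dh | apply Rmult_comm].
  - intros t _.
    apply (continuous_plus (fun t => m * (X2 t * cosh (X1 t)) * h t)
      (fun t => m * sinh (X1 t) * h1 t)).
    + apply (continuous_mult (fun t => m * (X2 t * cosh (X1 t))) h);
        [|apply is_derive_continuous with (1 := dh t)].
      apply (continuous_scal_r m (fun t => X2 t * cosh (X1 t))).
      apply (continuous_mult X2 (fun t => cosh (X1 t))); [apply cX2|].
      apply continuous_cosh, cX1.
    + apply (continuous_mult (fun t => m * sinh (X1 t)) h1); [|apply ch1].
      apply is_derive_continuous with (1 := dsinh t). }
rewrite (RInt_ext _ G1).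
- rewrite (is_RInt_unique _ _ _ _ HI); unfold G; rewrite ha, hb.
  unfold minus, plus, opp; simpl; ring.
- intros t; rewrite Rmin_left, Rmax_right by lra; intros Ht.
  assert (HV' : Derive V (X t) = - (m * cosh (X1 t) * X2 t)).
  { assert (Hi : Icc a b t) by (unfold Icc; lra).
    specialize (HEL t Hi); lra. }
  unfold G1; rewrite HV'; simpl; ring.
Qed.

Theorem theorem8p5 (a b m : R) (V xi : R -> R) :
  a < b -> 0 < m -> C2 V -> C2_on a b xi ->
  euler_lagrange m V a b xi ->
  (exists c : R, a < c < b /\ conjugate m V a b xi c) ->
  ~ strict_local_minimizer m V a b xi.
Proof.
intros Hab Hm HV Hxi HEL [c [Hc [_ [u [Hu [HJ [[t0 [Ht0 Hut0]] [ua uc]]]]]]]]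
  [eps [Heps Hmin]].
destruct (C2_on_extension a b xi Hab Hxi) as [X [X1 [X2 [dX [dX1 [cX2 EX]]]]]].
destruct (C2_on_extension a b u Hab Hu) as [U [U1 [U2 [dU [dU1 [cU2 EU]]]]]].
assert (cX : forall t, continuous X t)
  by (intros t; apply is_derive_continuous with (1 := dX t)).
assert (cX1 : forall t, continuous X1 t)
  by (intros t; apply is_derive_continuous with (1 := dX1 t)).
assert (cU1 : forall t, continuous U1 t)
  by (intros t; apply is_derive_continuous with (1 := dU1 t)).
set (P := fun t => m * cosh (X1 t)).
set (q := fun t => Derive (Derive V) (X t)).
assert (cP : forall t, continuous P t).
{ intros t; apply (continuous_scal_r m (fun t => cosh (X1 t))).
  apply continuous_cosh, cX1. }
assert (P0 : forall t, 0 < P t)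
  by (intros t; apply Rmult_lt_0_compat; [exact Hm | apply cosh_pos]).
assert (cq : forall t, continuous q t)
  by (intros t; apply (continuous_comp X); [apply cX | apply HV]).
assert (dW : forall t, Icc a b t ->
  is_derive (fun s => P s * U1 s) t (- (q t * U t))).
{ intros t Ht.
  assert (dP : is_derive P t (m * (X2 t * sinh (X1 t)))).
  { apply (is_derive_scal (fun t => cosh (X1 t))).
    apply (is_derive_comp cosh X1); [apply is_derive_cosh | apply dX1]. }
  assert (HD : is_derive (fun s => P s * U1 s) t
    (m * (X2 t * sinh (X1 t)) * U1 t + P t * U2 t))
    by (apply (is_derive_mult P U1); [exact dP | apply dU1 | apply Rmult_comm]).
  evar_last; [exact HD|].
  assert (HJt := HJ t Ht).
  (* The derivative relative to the interval in the Jacobi equation equals the two-sided derivative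
     of the extended product, endpoints included. *)
  rewrite (Derive_on_is_derive a b _ _ t _ Hab Ht) with (2 := HD) in HJt.
  - destruct (EX t Ht) as [Ext _]; destruct (EU t Ht) as [Eut _].
    rewrite Ext, Eut in HJt; unfold q; lra.
  - intros s Hs; unfold P; simpl.
    destruct (EX s Hs) as [_ [-> _]]; now destruct (EU s Hs) as [_ [-> _]]. }
assert (Ha : Icc a b a) by (unfold Icc; lra).
assert (Hb : Icc a b b) by (unfold Icc; lra).
assert (Hci : Icc a b c) by (unfold Icc; lra).
assert (Ua : U a = 0) by (now rewrite <- (proj1 (EU a Ha))).
assert (Uc : U c = 0) by (now rewrite <- (proj1 (EU c Hci))).
assert (U1c : U1 c <> 0).
{ intros U1c; apply Hut0; rewrite (proj1 (EU t0 Ht0)).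
  apply (sturm_liouville_unique a b c P q U U1); auto. }
destruct (negative_second_variation a b c P q U U1)
  as [h [h1 [dh [ch1 [ha [hb HQ]]]]]]; auto.
assert (ch : forall t, continuous h t)
  by (intros t; apply is_derive_continuous with (1 := dh t)).
destruct (second_variation_decrease m a b V X X1 h h1) as [r [Hr Hdec]]; auto.
{ apply first_variation_zero with X2; auto.
  intros t Ht; specialize (HEL t Ht).
  destruct (EX t Ht) as [E0 [E1 E2]]; now rewrite E0, E1, E2 in HEL. }
assert (Hab' : a <= b) by lra.
destruct (continuous_bounded a b h Hab' (fun t _ => ch t)) as [M [M0 HM]].
destruct (continuous_bounded a b h1 Hab' (fun t _ => ch1 t)) as [M' [M'0 HM']].
(* Small enough both for the action to decrease and for the C1 norm of [s h], at most [s (M + M')],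
   to stay below [eps]. The added 1 keeps the denominator positive. *)
set (s := Rmin (r / 2) (eps / (2 * (M + M' + 1)))).
assert (Hs0 : 0 < s) by (apply Rmin_pos; [lra|]; apply Rdiv_lt_0_compat; lra).
assert (Hsr : s < r) by (pose proof (Rmin_l (r / 2) (eps / (2 * (M + M' + 1)))); unfold s; lra).
assert (HsM : s * (M + M') < eps).
{ assert (H : s <= eps / (2 * (M + M' + 1))) by apply Rmin_r.
  apply Rle_div_r in H; [nra | lra]. }
set (eta := fun t => s * h t).
assert (deta : forall t, is_derive eta t (s * h1 t))
  by (intros t; apply (is_derive_scal h), dh).
assert (Deta : forall t, Icc a b t -> Derive_on a b eta t = s * h1 t)
  by (intros t Ht; now apply Derive_on_is_derive with eta).
destruct (sup_norm_bounds a b (s * M) eta Hab') as [B1 B2].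
{ intros t Ht; unfold eta; rewrite Rabs_mult, (Rabs_right s) by lra.
  apply Rmult_le_compat_l; [lra | now apply HM]. }
destruct (sup_norm_bounds a b (s * M') (Derive_on a b eta) Hab') as [B3 B4].
{ intros t Ht; rewrite Deta, Rabs_mult, (Rabs_right s) by (trivial; lra).
  apply Rmult_le_compat_l; [lra | now apply HM']. }
specialize (Hdec s (conj Hs0 Hsr)).
assert (Hlt : action m V a b (fun t => xi t + eta t) < action m V a b xi).
{ unfold action.
  rewrite (RInt_ext _
    (fun t => m * (cosh (X1 t + s * h1 t) - 1) - V (X t + s * h t))).
  - rewrite (RInt_ext (fun t => m * (cosh (Derive_on a b xi t) - 1) - V (xi t))
      (fun t => m * (cosh (X1 t) - 1) - V (X t))); [exact Hdec|].
    intros t; rewrite Rmin_left, Rmax_right by lra; intros Ht.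
    destruct (EX t) as [-> [-> _]]; [unfold Icc; lra | reflexivity].
  - intros t; rewrite Rmin_left, Rmax_right by lra; intros Ht.
    assert (Hti : Icc a b t) by (unfold Icc; lra).
    rewrite (Derive_on_is_derive a b _ (fun t => X t + eta t) t (X1 t + s * h1 t));
      [| exact Hab | exact Hti | |].
    + now rewrite (proj1 (EX t Hti)).
    + intros y Hy; now rewrite (proj1 (EX y Hy)).
    + apply (is_derive_plus X eta); [apply dX | apply deta]. }
apply (Rlt_asym _ _ Hlt), Hmin.
- apply C1_on_is_derive with eta (fun t => s * h1 t); auto.
  intros t; apply (continuous_scal_r s h1), ch1.
- unfold eta; rewrite ha; ring.
- unfold eta; rewrite hb; ring.
- split; [|unfold C1_norm; lra].
  (* A variation of zero norm would force [h] and [h1] to vanish on [(a, b)], making the second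
     variation zero instead of negative. *)
  apply Rnot_le_lt; intros Hle; unfold C1_norm in Hle.
  apply (Rlt_not_eq _ _ HQ).
  rewrite (RInt_ext _ (fun _ => 0)).
  + rewrite RInt_const; unfold scal; simpl; unfold mult; simpl; ring.
  + intros t; rewrite Rmin_left, Rmax_right by lra; intros Ht.
    assert (Hti : Icc a b t) by (unfold Icc; lra).
    pose proof (B2 t Hti) as N1; pose proof (B4 t Hti) as N2.
    pose proof (Rabs_pos (eta t)); pose proof (Rabs_pos (Derive_on a b eta t)).
    assert (E1 : s * h t = 0).
    { change (eta t = 0); apply Rabs_eq_0; lra. }
    assert (E2 : s * h1 t = 0).
    { rewrite <- Deta by exact Hti; apply Rabs_eq_0; lra. }
    apply Rmult_integral in E1; apply Rmult_integral in E2.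
    destruct E1 as [E1|E1]; [lra|]; destruct E2 as [E2|E2]; [lra|].
    rewrite E1, E2; simpl; ring.
Qed.
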